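(* Let $p,r,s>0$ be real parameters and consider the planar system $$\dot x=-x-y,\qquad \dot y=px+ry-sy^2-y^3 .$$ The equilibrium at the origin undergoes a Hopf bifurcation at $r=1$ for $p>1$ (with $r$ as the bifurcation parameter). More precisely, let $l_1$ and $l_2$ denote the first and second Lyapunov coefficients of the origin at $r=1$. Then: 1. For $r=1$ and $p>1$ there is a Hopf bifurcation at the origin. 2. If $1<p<1+\tfrac23 s^2$, the Hopf bifurcation is subcritical ($l_1>0$). 3. If $p>1+\tfrac23 s^2$, the Hopf bifurcation is supercritical ($l_1<0$). 4. If $p=1+\tfrac23 s^2$, there is a codimension-2 Bautin (generalized Hopf) bifurcation at the origin (at $(r,p)=(1,1+\tfrac23s^2)$, with $(r,p)$ as the bifurcation parameters). In this case the second Lyapunov coefficient satisfies $$l_2=-\frac{5(3+2s^2)^4}{128\sqrt6\,s^7}<0\qquad\text{for all } s>0 .$$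
   Context: Lyapunov coefficients are computed with the standard normal form formulas (Kuznetsov). At $r=1$, $p>1$, the Jacobian at the origin is $\mathcal A=\begin{pmatrix}-1&-1\\ p&1\end{pmatrix}$ with eigenvalues $\pm i\omega$, $\omega=\sqrt{p-1}$. Take $$\mathbf q=\Big(\frac{\omega+i}{2\omega},\,-\frac{(1+\omega^2)i}{2\omega}\Big)^T,\qquad \mathbf p=\Big(1,\,\frac{1-i\omega}{1+\omega^2}\Big)^T,$$ so that $\mathcal A\mathbf q=i\omega\mathbf q$, $\mathcal A^T\mathbf p=-i\omega\mathbf p$ and $\langle\mathbf p,\mathbf q\rangle=\bar p_1q_1+\bar p_2q_2=1$. Write $(x,y)^T=z\mathbf q+\bar z\bar{\mathbf q}$ with $z\in\mathbb C$, so that the system becomes $\dot z=i\omega z+\sum_{j+k\ge2}\frac{1}{j!k!}g_{jk}z^j\bar z^k$. Then $$l_1=\frac{1}{2\omega^2}\operatorname{Re}\big(i g_{20}g_{11}+\omega g_{21}\big),$$ and, when $l_1=0$, $$\begin{aligned}12\,l_2={}&\tfrac1\omega\operatorname{Re}g_{32}+\tfrac1{\omega^2}\operatorname{Im}\big[g_{20}\bar g_{31}-g_{11}(4g_{31}+3\bar g_{22})-\tfrac13g_{02}(g_{40}+\bar g_{13})-g_{30}g_{12}\big]\\&+\tfrac1{\omega^3}\Big\{\operatorname{Re}\big[g_{20}\big(\bar g_{11}(3g_{12}-\bar g_{30})+g_{02}(\bar g_{12}-\tfrac13g_{30})+\tfrac13\bar g_{02}g_{03}\big)\\&\qquad+g_{11}\big(\bar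 g_{02}(\tfrac53\bar g_{30}+3g_{12})+\tfrac13g_{02}\bar g_{03}-4g_{11}g_{30}\big)\big]+3\operatorname{Im}[g_{20}g_{11}]\operatorname{Im}g_{21}\Big\}\\&+\tfrac1{\omega^4}\Big\{\operatorname{Im}\big[g_{11}\bar g_{02}(\bar g_{20}^2-3\bar g_{20}g_{11}-4g_{11}^2)\big]+\operatorname{Im}[g_{20}g_{11}]\big(3\operatorname{Re}[g_{20}g_{11}]-2|g_{02}|^2\big)\Big\}.\end{aligned}$$ A Hopf bifurcation means that a complex conjugate pair of eigenvalues crosses the imaginary axis transversally as the parameter varies; it is subcritical if $l_1>0$ (the bifurcating limit cycle is unstable) and supercritical if $l_1<0$ (the bifurcating limit cycle is stable). A Bautin (generalized Hopf) bifurcation means: purely imaginary eigenvalues $\pm i\omega$ with $\omega>0$, $l_1=0$, $l_2\neq0$, and the map $(r,p)\mapsto(\mu(r,p),l_1(r,p))$ is regular at the bifurcation point, where $\mu(r,p)$ is the real part of the eigenvalues and $l_1(r,p)$ is the first Lyapunov coefficient extended to nearby parameter values. *)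

(* Defs.v *)
(* Stdlib reals with Coquelicot. *)
From Stdlib Require Import Reals Lra.
From Coquelicot Require Import Coquelicot.
Open Scope R_scope.

Record planar_field : Type := PlanarField {
  vx : R -> R -> R;
  vy : R -> R -> R
}.

Definition equilibrium_origin (f : planar_field) : Prop :=
  vx f 0 0 = 0 /\ vy f 0 0 = 0.

Record mat2 : Type := Mat2 { m11 : R; m12 : R; m21 : R; m22 : R }.

Definition mat2_mul (A : mat2) (v : C * C) : C * C :=
  (m11 A * fst v + m12 A * snd v, m21 A * fst v + m22 A * snd v)%C.

Definition mat2_tr (A : mat2) : mat2 := Mat2 (m11 A) (m21 A) (m12 A) (m22 A).

Definition scale2 (c : C) (v : C * C) : C * C := (c * fst v, c * snd v)%C.

Definition eigenvalue2 (A : mat2) (lam : C) : Prop :=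
  exists v : C * C, v <> (RtoC 0, RtoC 0) /\ mat2_mul A v = scale2 lam v.

(* Conjugate-linear in the first argument. *)
Definition herm2 (u v : C * C) : C :=
  (Cconj (fst u) * fst v + Cconj (snd u) * snd v)%C.

Definition jacobian0 (f : planar_field) : mat2 :=
  Mat2 (Derive (fun x => vx f x 0) 0) (Derive (fun y => vx f 0 y) 0)
       (Derive (fun x => vy f x 0) 0) (Derive (fun y => vy f 0 y) 0).

Definition normalized_eigenvectors (A : mat2) (lam : C) (q w : C * C) : Prop :=
  mat2_mul A q = scale2 lam q /\
  mat2_mul (mat2_tr A) w = scale2 (Cconj lam) w /\
  herm2 w q = RtoC 1.

(* A pair lam r, conj (lam r) of eigenvalues equals +/- i om at r = a and
   crosses the imaginary axis there with nonzero speed. *)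
Definition hopf_bifurcation (F : R -> planar_field) (a om : R) : Prop :=
  exists lam : R -> C,
    locally a (fun r =>
      equilibrium_origin (F r) /\
      eigenvalue2 (jacobian0 (F r)) (lam r) /\
      eigenvalue2 (jacobian0 (F r)) (Cconj (lam r))) /\
    0 < om /\ lam a = (Ci * om)%C /\
    ex_derive (fun r => Im (lam r)) a /\
    exists speed : R, is_derive (fun r => Re (lam r)) a speed /\ speed <> 0.

(* The right-hand side of dz/dt when (x, y) = z q + conj z conj q (a real
   vector, so Re only changes the type) and z = <w, (x, y)>. *)
Definition complex_rhs (f : planar_field) (q w : C * C) (z : C) : C :=
  let x := Re (z * fst q + Cconj z * Cconj (fst q))%C in
  let y := Re (z * snd q + Cconj z * Cconj (snd q))%C in
  herm2 w (RtoC (vx f x y), RtoC (vy f x y)).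

Definition partial_re (h : C -> C) (z : C) : C :=
  (Derive (fun t => Re (h (t, Im z))) (Re z),
   Derive (fun t => Im (h (t, Im z))) (Re z)).

Definition partial_im (h : C -> C) (z : C) : C :=
  (Derive (fun t => Re (h (Re z, t))) (Im z),
   Derive (fun t => Im (h (Re z, t))) (Im z)).

(* Wirtinger derivatives. *)
Definition d_z (h : C -> C) (z : C) : C :=
  ((partial_re h z - Ci * partial_im h z) / 2)%C.

Definition d_zbar (h : C -> C) (z : C) : C :=
  ((partial_re h z + Ci * partial_im h z) / 2)%C.

(* g_jk, i.e. j! k! times the coefficient of z^j (conj z)^k in the Taylor
   expansion of dz/dt. *)
Definition gcoef (f : planar_field) (q w : C * C) (j k : nat) : C :=
  Nat.iter j d_z (Nat.iter k d_zbar (complex_rhs f q w)) (RtoC 0).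

Definition lyap1 (f : planar_field) (om : R) (q w : C * C) : R :=
  let g := gcoef f q w in
  1 / (2 * om ^ 2) *
  Re (Ci * g 2%nat 0%nat * g 1%nat 1%nat + om * g 2%nat 1%nat)%C.

Definition lyap2 (f : planar_field) (om : R) (q w : C * C) : R :=
  let g := gcoef f q w in
  let g20 := g 2%nat 0%nat in
  let g11 := g 1%nat 1%nat in
  let g02 := g 0%nat 2%nat in
  let g30 := g 3%nat 0%nat in
  let g21 := g 2%nat 1%nat in
  let g12 := g 1%nat 2%nat in
  let g03 := g 0%nat 3%nat in
  let g40 := g 4%nat 0%nat in
  let g31 := g 3%nat 1%nat in
  let g22 := g 2%nat 2%nat in
  let g13 := g 1%nat 3%nat in
  let g32 := g 3%nat 2%nat in
  / 12 *
  ( 1 / om * Re g32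
  + 1 / om ^ 2 *
      Im (g20 * Cconj g31 - g11 * (4 * g31 + 3 * Cconj g22)
          - 1 / 3 * g02 * (g40 + Cconj g13) - g30 * g12)%C
  + 1 / om ^ 3 *
      ( Re (g20 * (Cconj g11 * (3 * g12 - Cconj g30)
                   + g02 * (Cconj g12 - 1 / 3 * g30)
                   + 1 / 3 * Cconj g02 * g03)
            + g11 * (Cconj g02 * (5 / 3 * Cconj g30 + 3 * g12)
                     + 1 / 3 * g02 * Cconj g03 - 4 * g11 * g30))%C
      + 3 * Im (g20 * g11)%C * Im g21)
  + 1 / om ^ 4 *
      ( Im (g11 * Cconj g02 *
            (Cconj g20 ^ 2 - 3 * Cconj g20 * g11 - 4 * g11 ^ 2))%C
      + Im (g20 * g11)%C * (3 * Re (g20 * g11)%C - 2 * Cmod g02 ^ 2))).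

(* First Lyapunov coefficient for eigenvalues lam, conj lam off the imaginary
   axis: with c1 the coefficient of z |z|^2 in the Poincare normal form,
   l1 = Re c1 / om - mu Im c1 / om^2, where lam = mu + i om
   (Kuznetsov, Elements of Applied Bifurcation Theory, 3.5 and 8.3).
   It reduces to lyap1 when mu = 0. *)
Definition lyap1_ext (f : planar_field) (lam : C) (q w : C * C) : R :=
  let g := gcoef f q w in
  let g20 := g 2%nat 0%nat in
  let g11 := g 1%nat 1%nat in
  let g02 := g 0%nat 2%nat in
  let g21 := g 2%nat 1%nat in
  let c1 :=
    (g20 * g11 * (2 * lam + Cconj lam) / (2 * (Cmod lam ^ 2)%R)
     + (Cmod g11 ^ 2)%R / lam
     + (Cmod g02 ^ 2)%R / (2 * (2 * lam - Cconj lam))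
     + g21 / 2)%C in
  Re c1 / Im lam - Re lam * Im c1 / Im lam ^ 2.

Definition subcritical_hopf
    (F : R -> planar_field) (a om : R) (q w : C * C) : Prop :=
  hopf_bifurcation F a om /\
  normalized_eigenvectors (jacobian0 (F a)) (Ci * om)%C q w /\
  0 < lyap1 (F a) om q w.

Definition supercritical_hopf
    (F : R -> planar_field) (a om : R) (q w : C * C) : Prop :=
  hopf_bifurcation F a om /\
  normalized_eigenvectors (jacobian0 (F a)) (Ci * om)%C q w /\
  lyap1 (F a) om q w < 0.

(* The map (f, g) has an invertible differential at (a, b). *)
Definition regular_at (f g : R -> R -> R) (a b : R) : Prop :=
  exists fa fb ga gb : R,
    differentiable_pt_lim f a b fa fb /\
    differentiable_pt_lim g a b ga gb /\
    fa * gb - fb * ga <> 0.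

(* lam, q, w give the eigenvalue with positive imaginary part and normalized
   eigenvectors at all parameter values near (a, b). *)
Definition bautin_bifurcation
    (F : R -> R -> planar_field)
    (lam : R -> R -> C) (q w : R -> R -> C * C) (a b : R) : Prop :=
  locally_2d (fun u v =>
    equilibrium_origin (F u v) /\
    0 < Im (lam u v) /\
    normalized_eigenvectors (jacobian0 (F u v)) (lam u v) (q u v) (w u v))
    a b /\
  Re (lam a b) = 0 /\
  lyap1 (F a b) (Im (lam a b)) (q a b) (w a b) = 0 /\
  lyap2 (F a b) (Im (lam a b)) (q a b) (w a b) <> 0 /\
  regular_at (fun u v => Re (lam u v))
             (fun u v => lyap1_ext (F u v) (lam u v) (q u v) (w u v)) a b.

Definition sys (s r p : R) : planar_field :=
  PlanarField (fun x y => - x - y)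
              (fun x y => p * x + r * y - s * y ^ 2 - y ^ 3).

Definition freq (p : R) : R := sqrt (p - 1).

Definition qvec (om : R) : C * C :=
  ((om + Ci) / (2 * om), - ((1 + om ^ 2) * Ci / (2 * om)))%C.

Definition wvec (om : R) : C * C :=
  (RtoC 1, (1 - Ci * om) / (1 + om ^ 2))%C.

(* The root with positive imaginary part of X^2 - (r - 1) X + (p - r), the
   characteristic polynomial at the origin. *)
Definition eig (r p : R) : C :=
  ((r - 1) / 2, sqrt (p - r - ((r - 1) / 2) ^ 2)).

(* Eigenvectors for (r, p) near r = 1, with the same normalization (first
   component of the adjoint vector equal to 1) as qvec and wvec. *)
Definition qvec_ext (r p : R) : C * C :=
  let q1 := (p / (p - (1 + eig r p) ^ 2))%C in
  (q1, - ((1 + eig r p) * q1))%C.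

Definition wvec_ext (r p : R) : C * C :=
  (RtoC 1, (1 + Cconj (eig r p)) / p)%C.

Lemma eig_at_1 (p : R) : eig 1 p = (Ci * freq p)%C.
Proof.
unfold eig, freq, Ci, RtoC, Cmult; simpl.
replace (p - 1 - (1 - 1) / 2 * ((1 - 1) / 2 * 1)) with (p - 1) by field.
f_equal; field.
Qed.

Lemma qvec_ext_at_1 (p : R) : 1 < p -> qvec_ext 1 p = qvec (freq p).
Proof.
intros hp; unfold qvec_ext; rewrite eig_at_1.
assert (h0 : 0 < freq p) by (apply sqrt_lt_R0; lra).
assert (h2 : p = 1 + freq p ^ 2) by (unfold freq; rewrite pow2_sqrt; lra).
revert h0 h2; generalize (freq p) as om; intros om h0 ->.
assert (hq : ((1 + om ^ 2)%R / ((1 + om ^ 2)%R - (1 + Ci * om) ^ 2))%C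
             = ((om + Ci) / (2 * om))%C).
{ unfold Cdiv, Cinv, Cminus, Cmult, Cplus, Copp, Ci, RtoC; simpl.
  f_equal; field; split; nra. }
rewrite hq; unfold qvec; f_equal.
unfold Cdiv, Cinv, Cminus, Cmult, Cplus, Copp, Ci, RtoC; simpl.
f_equal; field; lra.
Qed.

Lemma wvec_ext_at_1 (p : R) : 1 < p -> wvec_ext 1 p = wvec (freq p).
Proof.
intros hp; unfold wvec_ext, wvec; rewrite eig_at_1.
assert (h2 : p = 1 + freq p ^ 2) by (unfold freq; rewrite pow2_sqrt; lra).
revert h2; generalize (freq p) as om; intros om ->; f_equal.
unfold Cdiv, Cinv, Cminus, Cmult, Cplus, Copp, Cconj, Ci, RtoC; simpl.
f_equal; field; nra.
Qed.

(* Main.v *)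
Require Import Defs.
From Stdlib Require Import Reals Lra Lia FunctionalExtensionality.
From Coquelicot Require Import Coquelicot.
Open Scope R_scope.

(** The linear change of variables turns the right-hand side of dz/dt into a
    sum of ridge functions c * phi (Re (a z + conj a conj z)), one for each
    linear term and one for the nonlinearity - s y^2 - y^3, which depends on y
    alone.  Each Wirtinger derivative of a ridge function is again a ridge
    function: d_z multiplies c by a, d_zbar multiplies c by conj a, and both
    replace phi by its derivative.  Hence (gcoef_sys) for j + k >= 2
      g_jk = conj w2 * q2^j * (conj q2)^k * phi^(j+k)(0),
    where phi^(2)(0) = - 2 s and phi^(3)(0) = - 6,
    and everything of order at least 4 vanishes.

    At r = 1, with om^2 = p - 1, this reduces the Lyapunov formulas to rational
    functions of om and s:
      l1 = (1 + om^2)^2 / (8 om^5) * (2 s^2 - 3 om^2)   (lyap1_critical),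
      l2 = - 5 (1 + om^2)^4 / (16 om^7) if 2 s^2 = 3 om^2   (lyap2_critical).
    The sign of l1 decides between the two kinds of Hopf bifurcation and its
    zero p = 1 + 2 s^2 / 3 is the Bautin point; sqrt 6 * s = 3 om there gives
    the stated form of l2.

    The real part of the eigenvalue is (r - 1) / 2, so the Hopf crossing has
    speed 1/2.  The differential of (mu, l1) is triangular because mu does not
    involve p; its determinant is half the partial derivative of l1 in p along
    r = 1, which the closed form of l1 shows to be nonzero.  Off that line there
    is no comparable closed form, but the extended l1 is differentiable in (r, p)
    because it is built from the eigenvalue by field operations and
    conjugation (Rdiff_lyap1_ext). *)

(** * Wirtinger jets *)

(** [h] has real partial derivatives at [z], and they are those of a function
    with d_z = [a] and d_zbar = [b].  Unlike the total operators, this records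
    that the derivatives exist, so that it is stable under sums. *)
Definition wirtinger_at (h : C -> C) (z a b : C) : Prop :=
  is_derive (fun t => Re (h (t, Im z))) (Re z) (Re (a + b)%C) /\
  is_derive (fun t => Im (h (t, Im z))) (Re z) (Im (a + b)%C) /\
  is_derive (fun t => Re (h (Re z, t))) (Im z) (Re (Ci * (a - b))%C) /\
  is_derive (fun t => Im (h (Re z, t))) (Im z) (Im (Ci * (a - b))%C).

Lemma wirtinger_at_eq (h : C -> C) (z a b : C) :
  wirtinger_at h z a b -> d_z h z = a /\ d_zbar h z = b.
Proof.
intros (h1 & h2 & h3 & h4).
assert (hre : partial_re h z = (a + b)%C)
  by (apply injective_projections; apply is_derive_unique; assumption).
assert (him : partial_im h z = (Ci * (a - b))%C)
  by (apply injective_projections; apply is_derive_unique; assumption).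
unfold d_z, d_zbar; rewrite hre, him.
destruct a as [a1 a2], b as [b1 b2].
unfold Cdiv, Cinv, Cminus, Cmult, Cplus, Copp, Ci, RtoC, Re, Im; simpl.
split; f_equal; field.
Qed.

(** [G j k] is the iterated derivative of [h], [j] times in z and [k] times in
    conj z; naming all of them at once lets an infinite family of differentiation
    steps be checked in one. *)
Definition wirtinger_jet (h : C -> C) (G : nat -> nat -> C -> C) : Prop :=
  (forall z, h z = G 0%nat 0%nat z) /\
  forall j k z, wirtinger_at (G j k) z (G (S j) k z) (G j (S k) z).

Lemma wirtinger_jet_iter (h : C -> C) (G : nat -> nat -> C -> C) (j k : nat) :
  wirtinger_jet h G -> Nat.iter j d_z (Nat.iter k d_zbar h) = G j k.
Proof.
intros [h0 hS].
assert (hk : Nat.iter k d_zbar h = G 0%nat k).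
{ induction k as [|k IH]; apply functional_extensionality; intros z; simpl.
  - apply h0.
  - rewrite IH; apply (wirtinger_at_eq _ _ _ _ (hS 0%nat k z)). }
rewrite hk; induction j as [|j IH]; [reflexivity|].
apply functional_extensionality; intros z; simpl.
rewrite IH; apply (wirtinger_at_eq _ _ _ _ (hS j k z)).
Qed.

Lemma wirtinger_at_plus (h1 h2 : C -> C) (z a1 b1 a2 b2 : C) :
  wirtinger_at h1 z a1 b1 -> wirtinger_at h2 z a2 b2 ->
  wirtinger_at (fun z => h1 z + h2 z)%C z (a1 + a2)%C (b1 + b2)%C.
Proof.
intros (p1 & p2 & p3 & p4) (q1 & q2 & q3 & q4).
split; [|split; [|split]].
- replace (Re (a1 + a2 + (b1 + b2))%C) with (Re (a1 + b1)%C + Re (a2 + b2)%C)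
    by (unfold Re, Cplus; simpl; ring).
  exact (is_derive_plus _ _ _ _ _ p1 q1).
- replace (Im (a1 + a2 + (b1 + b2))%C) with (Im (a1 + b1)%C + Im (a2 + b2)%C)
    by (unfold Im, Cplus; simpl; ring).
  exact (is_derive_plus _ _ _ _ _ p2 q2).
- replace (Re (Ci * (a1 + a2 - (b1 + b2)))%C)
    with (Re (Ci * (a1 - b1))%C + Re (Ci * (a2 - b2))%C)
    by (unfold Re, Cminus, Cmult, Cplus, Copp; simpl; ring).
  exact (is_derive_plus _ _ _ _ _ p3 q3).
- replace (Im (Ci * (a1 + a2 - (b1 + b2)))%C)
    with (Im (Ci * (a1 - b1))%C + Im (Ci * (a2 - b2))%C)
    by (unfold Im, Cminus, Cmult, Cplus, Copp; simpl; ring).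
  exact (is_derive_plus _ _ _ _ _ p4 q4).
Qed.

Lemma wirtinger_jet_plus (h1 h2 : C -> C) (G1 G2 : nat -> nat -> C -> C) :
  wirtinger_jet h1 G1 -> wirtinger_jet h2 G2 ->
  wirtinger_jet (fun z => h1 z + h2 z)%C (fun j k z => G1 j k z + G2 j k z)%C.
Proof.
intros [e1 d1] [e2 d2]; split.
- intros z; now rewrite e1, e2.
- intros j k z; apply wirtinger_at_plus; auto.
Qed.

(** The real coordinate of the vector z q + conj z conj q whose entry of q is
    [a]. *)
Definition coord (a z : C) : R := Re (z * a + Cconj z * Cconj a)%C.

(** The chain rule: [coord a] is real-linear, with d_z = [a] and
    d_zbar = conj [a]. *)
Lemma wirtinger_at_ridge (c a z : C) (phi : R -> R) (l : R) :
  is_derive phi (coord a z) l ->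
  wirtinger_at (fun z => c * RtoC (phi (coord a z)))%C z
    (c * a * RtoC l)%C (c * Cconj a * RtoC l)%C.
Proof.
intros hphi.
assert (dre : is_derive (fun t => phi (coord a (t, Im z))) (Re z)
                (2 * Re a * l)).
{ replace (2 * Re a * l) with (scal (2 * Re a) l) by reflexivity.
  apply (is_derive_comp phi (fun t => coord a (t, Im z))).
  - destruct z; exact hphi.
  - unfold coord, Cconj, Cmult, Cplus, Re, Im; simpl; auto_derive; [exact I|ring]. }
assert (dim : is_derive (fun t => phi (coord a (Re z, t))) (Im z)
                (- 2 * Im a * l)).
{ replace (- 2 * Im a * l) with (scal (- 2 * Im a) l) by reflexivity.
  apply (is_derive_comp phi (fun t => coord a (Re z, t))).
  - destruct z; exact hphi.
  - unfold coord, Cconj, Cmult, Cplus, Re, Im; simpl; auto_derive; [exact I|ring]. }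
assert (aux : forall (f g : R -> R) x d m e, is_derive f x d ->
                (forall t, m * f t = g t) -> m * d = e -> is_derive g x e).
{ intros f g x d m e hd hg <-.
  exact (is_derive_ext _ _ _ _ hg (is_derive_scal f x m d hd)). }
split; [|split; [|split]];
  [ apply (aux _ _ _ _ (Re c) _ dre) | apply (aux _ _ _ _ (Im c) _ dre)
  | apply (aux _ _ _ _ (Re c) _ dim) | apply (aux _ _ _ _ (Im c) _ dim) ];
  try intros t;
  unfold Re, Im, Cminus, Copp, Cmult, Cplus, Cconj, RtoC, Ci; simpl; ring.
Qed.

Definition derive_seq (phi : nat -> R -> R) : Prop :=
  forall n x, is_derive (phi n) x (phi (S n) x).

Lemma wirtinger_jet_ridge (c a : C) (phi : nat -> R -> R) :
  derive_seq phi ->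
  wirtinger_jet (fun z => c * RtoC (phi 0%nat (coord a z)))%C
    (fun j k z =>
       c * a ^ j * Cconj a ^ k * RtoC (phi (j + k)%nat (coord a z)))%C.
Proof.
intros hphi; split.
- intros z; simpl; ring.
- intros j k z.
  pose proof (wirtinger_at_ridge (c * a ^ j * Cconj a ^ k)%C a z _ _
                (hphi (j + k)%nat (coord a z))) as H.
  rewrite Nat.add_succ_r; simpl (S j + k)%nat.
  replace (c * a ^ S j * Cconj a ^ k)%C with (c * a ^ j * Cconj a ^ k * a)%C
    by (simpl; ring).
  replace (c * a ^ j * Cconj a ^ S k)%C
    with (c * a ^ j * Cconj a ^ k * Cconj a)%C by (simpl; ring).
  exact H.
Qed.

(** * Taylor coefficients of the system *)

Definition id_seq (n : nat) (x : R) : R :=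
  match n with 0%nat => x | 1%nat => 1 | _ => 0 end.

Definition cubic_seq (s : R) (n : nat) (y : R) : R :=
  match n with
  | 0%nat => - s * y ^ 2 - y ^ 3
  | 1%nat => - 2 * s * y - 3 * y ^ 2
  | 2%nat => - 2 * s - 6 * y
  | 3%nat => - 6
  | _ => 0
  end.

Lemma derive_seq_id : derive_seq id_seq.
Proof.
intros [|[|n]] x;
  [exact (is_derive_id x) | exact (is_derive_const 1 x)
  | exact (is_derive_const 0 x)].
Qed.

Lemma derive_seq_cubic (s : R) : derive_seq (cubic_seq s).
Proof. intros [|[|[|[|n]]]] x; unfold cubic_seq; auto_derive; auto; simpl; ring. Qed.

(** The right-hand side is a sum of three ridge functions: the linear terms in x
    and in y, whose derivatives of order at least 2 vanish, and the nonlinearity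
    in y. *)
Lemma gcoef_sys (s r p : R) (q w : C * C) (j k : nat) :
  (2 <= j + k)%nat ->
  gcoef (sys s r p) q w j k =
  (Cconj (snd w) * snd q ^ j * Cconj (snd q) ^ k *
   RtoC (cubic_seq s (j + k) 0))%C.
Proof.
intros hjk.
pose proof (wirtinger_jet_plus _ _ _ _
  (wirtinger_jet_plus _ _ _ _
    (wirtinger_jet_ridge (p * Cconj (snd w) - Cconj (fst w))%C (fst q)
       id_seq derive_seq_id)
    (wirtinger_jet_ridge (r * Cconj (snd w) - Cconj (fst w))%C (snd q)
       id_seq derive_seq_id))
  (wirtinger_jet_ridge (Cconj (snd w)) (snd q) (cubic_seq s)
     (derive_seq_cubic s))) as H.
unfold gcoef.
match type of H with wirtinger_jet ?h _ =>
  replace (complex_rhs (sys s r p) q w) with h end.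
- rewrite (wirtinger_jet_iter _ _ j k H).
  assert (hid : forall x, id_seq (j + k) x = 0)
    by (intros x; destruct (j + k)%nat as [|[|n]]; [lia|lia|reflexivity]).
  assert (hc : coord (snd q) 0 = 0)
    by (unfold coord, Re, Cconj, Cmult, Cplus; simpl; ring).
  rewrite !hid, hc; ring.
- apply functional_extensionality; intros z.
  unfold complex_rhs, herm2; cbn -[Cmult Cplus pow].
  fold (coord (fst q) z) (coord (snd q) z).
  rewrite !RtoC_minus, !RtoC_plus, !RtoC_mult, !RtoC_opp.
  ring.
Qed.

(** * Lyapunov coefficients on the critical line *)

(** With conj w2 = (1 + i om) / (1 + om^2) and
    q2 = - i (1 + om^2) / (2 om), the second-order coefficients are
    [quad_amp] * (1 + i om) and the third-order ones are [cubic_amp] * (1 + i om),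
    each up to a power of i. *)
Definition quad_amp (s om : R) : R := s * (1 + om ^ 2) / (2 * om ^ 2).
Definition cubic_amp (om : R) : R := 3 * (1 + om ^ 2) ^ 2 / (4 * om ^ 3).

Lemma gcoef_critical (s p om : R) : 0 < om ->
  let g := gcoef (sys s 1 p) (qvec om) (wvec om) in
  let B := quad_amp s om in let E := cubic_amp om in
  g 2%nat 0%nat = (B, B * om) /\ g 1%nat 1%nat = (- B, - (B * om)) /\
  g 0%nat 2%nat = (B, B * om) /\
  g 3%nat 0%nat = (E * om, - E) /\ g 2%nat 1%nat = (- (E * om), E) /\
  g 1%nat 2%nat = (E * om, - E) /\ g 0%nat 3%nat = (- (E * om), E).
Proof.
intros hom g B E.
assert (hq : snd (qvec om) = (0, - ((1 + om ^ 2) / (2 * om)))).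
{ unfold qvec, Cdiv, Cinv, Copp, Cmult, Cplus, Ci, RtoC; simpl.
  f_equal; field; lra. }
assert (hw : Cconj (snd (wvec om)) = (1 / (1 + om ^ 2), om / (1 + om ^ 2))).
{ unfold wvec, Cdiv, Cinv, Cconj, Cminus, Copp, Cmult, Cplus, Ci, RtoC; simpl.
  f_equal; field; nra. }
unfold g, B, E, quad_amp, cubic_amp; repeat split;
  (rewrite gcoef_sys by (simpl; lia); rewrite hq, hw;
   unfold Cmult, Cconj, RtoC; simpl; f_equal; field; nra).
Qed.

Lemma gcoef_high (s r p : R) (q w : C * C) (j k : nat) :
  (4 <= j + k)%nat -> gcoef (sys s r p) q w j k = RtoC 0.
Proof.
intros hjk; rewrite gcoef_sys by lia.
destruct (j + k)%nat as [|[|[|[|n]]]]; try lia; simpl; ring.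
Qed.

Lemma lyap1_critical (s p om : R) : 0 < om ->
  lyap1 (sys s 1 p) om (qvec om) (wvec om) =
  (1 + om ^ 2) ^ 2 / (8 * om ^ 5) * (2 * s ^ 2 - 3 * om ^ 2).
Proof.
intros hom.
destruct (gcoef_critical s p om hom) as (g20 & g11 & g02 & g30 & g21 & _).
unfold lyap1; rewrite g20, g11, g21.
unfold quad_amp, cubic_amp, Cmult, Cplus, Ci, RtoC, Re; simpl; field; lra.
Qed.

Lemma Cmod_sqr (z : C) : Cmod z ^ 2 = Re z ^ 2 + Im z ^ 2.
Proof.
unfold Cmod, Re, Im; rewrite pow2_sqrt; [reflexivity|].
destruct z; simpl; nra.
Qed.

Lemma lyap2_critical (s p om : R) : 0 < om -> 2 * s ^ 2 = 3 * om ^ 2 ->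
  lyap2 (sys s 1 p) om (qvec om) (wvec om) =
  - (5 * (1 + om ^ 2) ^ 4 / (16 * om ^ 7)).
Proof.
intros hom hs.
destruct (gcoef_critical s p om hom)
  as (g20 & g11 & g02 & g30 & g21 & g12 & g03).
assert (hB : quad_amp s om ^ 2 = 3 * (1 + om ^ 2) ^ 2 / (8 * om ^ 2)).
{ unfold quad_amp.
  replace ((s * (1 + om ^ 2) / (2 * om ^ 2)) ^ 2)
    with (2 * s ^ 2 * (1 + om ^ 2) ^ 2 / (8 * om ^ 4)) by (field; lra).
  rewrite hs; field; lra. }
unfold lyap2; rewrite Cmod_sqr, g20, g11, g02, g30, g21, g12, g03.
rewrite !gcoef_high by (simpl; lia).
(* The formula is even in the quadratic amplitude, the only place where s
   occurs, so that its square, a function of om alone, suffices. *)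
transitivity
  (/ 12 * (2 * cubic_amp om ^ 2 / om
           - quad_amp s om ^ 2 * cubic_amp om * (82 / 3 + 4 * om ^ 2) / om ^ 2
           + (quad_amp s om ^ 2) ^ 2 * (20 + 8 * om ^ 2) / om ^ 3)).
- generalize (quad_amp s om) as B, (cubic_amp om) as E; intros B E.
  unfold Cdiv, Cinv, Cconj, Cminus, Copp, Cmult, Cplus, RtoC, Re, Im; simpl.
  field; lra.
- rewrite hB; unfold cubic_amp; field; lra.
Qed.

(** * Eigenvalues and eigenvectors near the critical line *)

Lemma jacobian0_sys (s r p : R) : jacobian0 (sys s r p) = Mat2 (-1) (-1) p r.
Proof.
unfold jacobian0, sys; simpl.
f_equal; apply is_derive_unique; auto_derive; auto; ring.
Qed.

(** Positivity of the imaginary part encodes that the discriminant is positive,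
    as the square root of a negative number is 0. *)
Lemma eig_char (r p : R) : 0 < Im (eig r p) ->
  (eig r p * eig r p = (r - 1) * eig r p - (p - r))%C.
Proof.
unfold eig; simpl; intros hpos.
set (d := p - r - (r - 1) / 2 * ((r - 1) / 2 * 1)) in *.
assert (hd : sqrt d * sqrt d = d).
{ apply sqrt_sqrt; destruct (Rle_lt_dec 0 d) as [h|h]; auto.
  rewrite sqrt_neg_0 in hpos; lra. }
unfold Cmult, Cminus, Cplus, Copp, RtoC; simpl.
f_equal; [rewrite hd; unfold d|]; field.
Qed.

Lemma eigenvalue2_sys (s r p : R) (l : C) :
  (l * l = (r - 1) * l - (p - r))%C ->
  eigenvalue2 (jacobian0 (sys s r p)) l.
Proof.
intros hl; rewrite jacobian0_sys; exists (RtoC 1, (- (1 + l))%C); split.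
- intros h; injection h; intros; lra.
- unfold mat2_mul, scale2; simpl; f_equal; [ring|].
  replace (l * - (1 + l))%C with (- l - l * l)%C by ring.
  rewrite hl; ring.
Qed.

Lemma charpoly_conj (l : C) (r p : R) :
  (l * l = (r - 1) * l - (p - r))%C ->
  (Cconj l * Cconj l = (r - 1) * Cconj l - (p - r))%C.
Proof.
intros hl; rewrite <- Cmult_conj, hl.
unfold Cconj, Cmult, Cminus, Cplus, Copp, RtoC; simpl; f_equal; ring.
Qed.

(** The imaginary part 2 (1 + mu) om of (1 + lam)^2 is nonzero when r > 0, as
    then 1 + mu = (r + 1) / 2 > 0. *)
Lemma qvec_ext_den (r p : R) : 0 < r -> 0 < Im (eig r p) ->
  (p - (1 + eig r p) ^ 2)%C <> RtoC 0.
Proof.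
intros hr; unfold eig; simpl; intros hi h.
injection h; intros h2 _; simpl in h2.
nra.
Qed.

(** The first row of each eigenvector equation holds by the choice of the
    vectors; the second row is the characteristic equation. *)
Lemma normalized_eigenvectors_ext (s r p : R) :
  0 < r -> 0 < p -> 0 < Im (eig r p) ->
  normalized_eigenvectors (jacobian0 (sys s r p)) (eig r p)
    (qvec_ext r p) (wvec_ext r p).
Proof.
intros hr hp hi.
pose proof (qvec_ext_den r p hr hi) as hden.
pose proof (eig_char r p hi) as hl.
pose proof (charpoly_conj _ _ _ hl) as hlc.
assert (hpc : RtoC p <> RtoC 0) by (intros h; injection h; lra).
rewrite jacobian0_sys; unfold qvec_ext, wvec_ext.
generalize dependent (eig r p); intros l hi hden hl hlc.
split; [|split]; unfold mat2_mul, mat2_tr, scale2, herm2;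
  cbn [m11 m12 m21 m22 fst snd].
- generalize (p / (p - (1 + l) ^ 2))%C; intros q1; f_equal; [ring|].
  replace (l * - ((1 + l) * q1))%C with (- (l * q1) - l * l * q1)%C by ring.
  rewrite hl; ring.
- f_equal; [field; exact hpc|].
  replace (Cconj l * ((1 + Cconj l) / p))%C
    with ((Cconj l + Cconj l * Cconj l) / p)%C by (field; exact hpc).
  rewrite hlc; field; exact hpc.
- replace (Cconj 1) with (RtoC 1) by (unfold Cconj, RtoC; simpl; f_equal; ring).
  rewrite Cdiv_conj, Cplus_conj, Cconj_conj by exact hpc.
  replace (Cconj 1) with (RtoC 1) by (unfold Cconj, RtoC; simpl; f_equal; ring).
  replace (Cconj p) with (RtoC p) by (unfold Cconj, RtoC; simpl; f_equal; ring).
  field; split; assumption.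
Qed.

(** A region around (1, p) on which the eigenvalues are not real; the eigenvector
    formulas also need both parameters positive there. *)
Lemma near_critical (p : R) : 1 < p ->
  locally_2d (fun u v => 0 < u /\ 0 < v /\ 0 < Im (eig u v)) 1 p.
Proof.
intros hp.
(* For a radius d <= 1/2 the discriminant v - u - ((u - 1) / 2)^2 differs from
   p - 1 by at most 2 d + d^2 / 4 < 3 d <= p - 1. *)
assert (hd : 0 < Rmin (1 / 2) ((p - 1) / 3)) by (apply Rmin_pos; lra).
exists (mkposreal _ hd); simpl; intros u v hu hv.
pose proof (Rmin_l (1 / 2) ((p - 1) / 3)).
pose proof (Rmin_r (1 / 2) ((p - 1) / 3)).
apply Rabs_def2 in hu; apply Rabs_def2 in hv.
split; [lra|]; split; [lra|].
apply sqrt_lt_R0; nra.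
Qed.

Lemma freq_pos (p : R) : 1 < p -> 0 < freq p.
Proof. intros hp; apply sqrt_lt_R0; lra. Qed.

Lemma freq_sqr (p : R) : 1 < p -> freq p ^ 2 = p - 1.
Proof. intros hp; apply pow2_sqrt; lra. Qed.

Lemma equilibrium_sys (s r p : R) : equilibrium_origin (sys s r p).
Proof. split; simpl; ring. Qed.

Lemma hopf_sys (s p : R) : 1 < p ->
  hopf_bifurcation (fun r => sys s r p) 1 (freq p).
Proof.
intros hp; exists (fun r => eig r p).
split; [|split; [|split; [|split]]].
- apply (locally_2d_1d_const_y (fun r p =>
    equilibrium_origin (sys s r p) /\
    eigenvalue2 (jacobian0 (sys s r p)) (eig r p) /\
    eigenvalue2 (jacobian0 (sys s r p)) (Cconj (eig r p)))).
  eapply locally_2d_impl; [|exact (near_critical p hp)].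
  apply locally_2d_forall; intros u v (_ & _ & hi).
  split; [apply equilibrium_sys|]; split; apply eigenvalue2_sys;
    [|apply charpoly_conj]; apply eig_char, hi.
- now apply freq_pos.
- apply eig_at_1.
- unfold eig; simpl; auto_derive.
  replace (_ + _) with (p - 1); [lra|field].
- exists (/ 2); split; [unfold eig; simpl; auto_derive; auto; field|lra].
Qed.

Lemma normalized_eigenvectors_critical (s p : R) : 1 < p ->
  normalized_eigenvectors (jacobian0 (sys s 1 p)) (Ci * freq p)%C
    (qvec (freq p)) (wvec (freq p)).
Proof.
intros hp.
rewrite <- eig_at_1, <- qvec_ext_at_1, <- wvec_ext_at_1 by exact hp.
destruct (locally_2d_singleton _ _ _ (near_critical p hp)) as (h1 & h2 & h3).
now apply normalized_eigenvectors_ext.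
Qed.

(** * Differentiable functions of the two parameters *)

Definition Rdiff (f : R -> R -> R) (a b : R) : Prop :=
  exists la lb, differentiable_pt_lim f a b la lb.

Definition Cdiff (h : R -> R -> C) (a b : R) : Prop :=
  Rdiff (fun u v => Re (h u v)) a b /\ Rdiff (fun u v => Im (h u v)) a b.

Lemma Rdiff_proj1 (a b : R) : Rdiff (fun u _ => u) a b.
Proof.
exists 1, 0; apply (differentiable_pt_lim_proj1_0 (fun u => u)).
apply derivable_pt_lim_id.
Qed.

Lemma Rdiff_const (c a b : R) : Rdiff (fun _ _ => c) a b.
Proof.
exists 0, 0; apply (differentiable_pt_lim_proj1_0 (fun _ => c)).
apply derivable_pt_lim_const.
Qed.

Lemma Rdiff_proj2 (a b : R) : Rdiff (fun _ v => v) a b.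
Proof.
exists 0, 1; intros eps; exists eps; intros u v _ hv.
replace (v - b - (0 * (u - a) + 1 * (v - b))) with 0 by ring.
rewrite Rabs_R0; apply Rmult_le_pos; [left; apply cond_pos|].
eapply Rle_trans; [apply Rabs_pos|apply Rmax_l].
Qed.

Lemma Rdiff_plus (f g : R -> R -> R) (a b : R) :
  Rdiff f a b -> Rdiff g a b -> Rdiff (fun u v => f u v + g u v) a b.
Proof.
intros (fa & fb & hf) (ga & gb & hg); eexists; eexists.
apply (differentiable_pt_lim_comp Rplus f g a b 1 1 fa fb ga gb); auto.
intros eps; exists eps; intros u v _ _.
match goal with |- Rabs ?e <= _ => replace e with 0 by ring end.
rewrite Rabs_R0; apply Rmult_le_pos; [left; apply cond_pos|].
eapply Rle_trans; [apply Rabs_pos|apply Rmax_l].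
Qed.

Lemma Rdiff_comp (phi : R -> R) (f : R -> R -> R) (a b : R) :
  ex_derive phi (f a b) -> Rdiff f a b -> Rdiff (fun u v => phi (f u v)) a b.
Proof.
intros [l hl] (fa & fb & hf); eexists; eexists.
apply (differentiable_pt_lim_comp (fun x _ => phi x) f f a b l 0 fa fb fa fb);
  auto.
apply differentiable_pt_lim_proj1_0, is_derive_Reals, hl.
Qed.

Lemma Rdiff_ext (f g : R -> R -> R) (a b : R) :
  (forall u v, f u v = g u v) -> Rdiff f a b -> Rdiff g a b.
Proof.
intros h (la & lb & hf); exists la, lb.
apply differentiable_pt_lim_ext with (2 := hf), locally_2d_forall, h.
Qed.

Lemma Rdiff_scal (c : R) (f : R -> R -> R) (a b : R) :
  Rdiff f a b -> Rdiff (fun u v => c * f u v) a b.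
Proof. intros hf; apply (Rdiff_comp (fun x => c * x)); [auto_derive|]; auto. Qed.

Lemma Rdiff_mult (f g : R -> R -> R) (a b : R) :
  Rdiff f a b -> Rdiff g a b -> Rdiff (fun u v => f u v * g u v) a b.
Proof.
intros hf hg.
(* Polarization reduces products to sums and to squares, which are
   compositions with a function of one variable. *)
apply Rdiff_ext with (fun u v =>
  / 4 * ((f u v + g u v) ^ 2 + - 1 * (f u v + - 1 * g u v) ^ 2)).
{ intros u v; field. }
assert (sq : forall h, Rdiff h a b -> Rdiff (fun u v => h u v ^ 2) a b)
  by (intros h hh; apply (Rdiff_comp (fun x => x ^ 2)); [auto_derive|]; auto).
auto 8 using Rdiff_scal, Rdiff_plus.
Qed.

Lemma Rdiff_minus (f g : R -> R -> R) (a b : R) :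
  Rdiff f a b -> Rdiff g a b -> Rdiff (fun u v => f u v - g u v) a b.
Proof.
intros hf hg; apply Rdiff_ext with (fun u v => f u v + - 1 * g u v).
{ intros; ring. }
auto using Rdiff_plus, Rdiff_scal.
Qed.

Lemma Rdiff_div (f g : R -> R -> R) (a b : R) :
  Rdiff f a b -> Rdiff g a b -> g a b <> 0 ->
  Rdiff (fun u v => f u v / g u v) a b.
Proof.
intros hf hg h0; apply Rdiff_mult; auto.
apply (Rdiff_comp Rinv); [auto_derive|]; auto.
Qed.

Lemma Cdiff_RtoC (f : R -> R -> R) (a b : R) :
  Rdiff f a b -> Cdiff (fun u v => RtoC (f u v)) a b.
Proof. intros hf; split; simpl; auto using Rdiff_const. Qed.

Lemma Cdiff_plus (f g : R -> R -> C) (a b : R) :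
  Cdiff f a b -> Cdiff g a b -> Cdiff (fun u v => f u v + g u v)%C a b.
Proof. intros [f1 f2] [g1 g2]; split; apply Rdiff_plus; assumption. Qed.

Lemma Cdiff_mult (f g : R -> R -> C) (a b : R) :
  Cdiff f a b -> Cdiff g a b -> Cdiff (fun u v => f u v * g u v)%C a b.
Proof.
intros [f1 f2] [g1 g2]; split; [apply Rdiff_minus|apply Rdiff_plus];
  apply Rdiff_mult; assumption.
Qed.

Lemma Cdiff_const (c : C) (a b : R) : Cdiff (fun _ _ => c) a b.
Proof. split; apply Rdiff_const. Qed.

Lemma Cdiff_opp (f : R -> R -> C) (a b : R) :
  Cdiff f a b -> Cdiff (fun u v => - f u v)%C a b.
Proof.
intros [f1 f2]; split; simpl.
- apply (Rdiff_comp Ropp (fun u v => Re (f u v))); [auto_derive|]; auto.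
- apply (Rdiff_comp Ropp (fun u v => Im (f u v))); [auto_derive|]; auto.
Qed.

Lemma Cdiff_minus (f g : R -> R -> C) (a b : R) :
  Cdiff f a b -> Cdiff g a b -> Cdiff (fun u v => f u v - g u v)%C a b.
Proof. intros hf hg; apply Cdiff_plus; auto using Cdiff_opp. Qed.

Lemma Cdiff_conj (f : R -> R -> C) (a b : R) :
  Cdiff f a b -> Cdiff (fun u v => Cconj (f u v)) a b.
Proof.
intros [f1 f2]; split; [exact f1|].
apply (Rdiff_comp Ropp (fun u v => Im (f u v))); [auto_derive|]; auto.
Qed.

Lemma Cdiff_pow (f : R -> R -> C) (n : nat) (a b : R) :
  Cdiff f a b -> Cdiff (fun u v => f u v ^ n)%C a b.
Proof.
intros hf; induction n as [|n IH]; simpl; [apply Cdiff_const|].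
now apply Cdiff_mult.
Qed.

Lemma Rdiff_Cmod_sqr (f : R -> R -> C) (a b : R) :
  Cdiff f a b -> Rdiff (fun u v => Cmod (f u v) ^ 2) a b.
Proof.
intros [f1 f2].
apply Rdiff_ext with (fun u v =>
  Re (f u v) * Re (f u v) + Im (f u v) * Im (f u v)).
{ intros u v; rewrite Cmod_sqr; ring. }
auto using Rdiff_plus, Rdiff_mult.
Qed.

Lemma Cdiff_div (f g : R -> R -> C) (a b : R) :
  Cdiff f a b -> Cdiff g a b -> g a b <> RtoC 0 ->
  Cdiff (fun u v => f u v / g u v)%C a b.
Proof.
intros hf hg h0; apply Cdiff_mult; auto.
assert (h2 : Cmod (g a b) ^ 2 <> 0).
{ apply pow_nonzero; intros h; apply h0, Cmod_eq_0, h. }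
pose proof (Rdiff_Cmod_sqr g a b hg) as hm.
destruct hg as [g1 g2]; split; unfold Cinv; simpl.
- apply Rdiff_ext with (fun u v => Re (g u v) / Cmod (g u v) ^ 2).
  { intros u v; now rewrite Cmod_sqr. }
  now apply Rdiff_div.
- apply Rdiff_ext with (fun u v => -1 * Im (g u v) / Cmod (g u v) ^ 2).
  { intros u v; rewrite Cmod_sqr; unfold Im, Re; f_equal; ring. }
  apply Rdiff_div; auto using Rdiff_scal.
Qed.

(** * Regularity of the first Lyapunov coefficient *)

(** Follows the syntax of the function; the pattern matching keeps a quotient
    from being unfolded into a product, and the nonvanishing of each denominator
    is left as a goal. *)
Ltac cdiff :=
  try assumption;
  lazymatch goal with
  | |- Cdiff (fun u v => Cplus (@?f u v) (@?g u v)) _ _ =>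
      apply Cdiff_plus; cdiff
  | |- Cdiff (fun u v => Cminus (@?f u v) (@?g u v)) _ _ =>
      apply Cdiff_minus; cdiff
  | |- Cdiff (fun u v => Copp (@?f u v)) _ _ => apply Cdiff_opp; cdiff
  | |- Cdiff (fun u v => Cmult (@?f u v) (@?g u v)) _ _ =>
      apply Cdiff_mult; cdiff
  | |- Cdiff (fun u v => Cdiv (@?f u v) (@?g u v)) _ _ =>
      apply Cdiff_div; cdiff
  | |- Cdiff (fun u v => Cconj (@?f u v)) _ _ => apply Cdiff_conj; cdiff
  | |- Cdiff (fun u v => Cpow (@?f u v) ?n) _ _ => apply Cdiff_pow; cdiff
  | |- Cdiff (fun u v => RtoC (Cmod (@?f u v) ^ 2)) _ _ =>
      apply Cdiff_RtoC, Rdiff_Cmod_sqr; cdiff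
  | |- Cdiff (fun u v => ?c) _ _ => apply Cdiff_const
  | _ => idtac
  end.

(** The Lyapunov coefficient is a rational function of lam, q2, w2 and their
    conjugates.  Its denominators are built from lam, Im lam and
    2 lam - conj lam, whose imaginary part is 3 Im lam. *)
Lemma Rdiff_lyap1_ext (s : R) (lam : R -> R -> C) (q w : R -> R -> C * C)
    (a b : R) :
  Cdiff lam a b -> Cdiff (fun u v => snd (q u v)) a b ->
  Cdiff (fun u v => snd (w u v)) a b -> 0 < Im (lam a b) ->
  Rdiff (fun u v => lyap1_ext (sys s u v) (lam u v) (q u v) (w u v)) a b.
Proof.
intros hl hq hw hi.
assert (hg : forall j k, (2 <= j + k)%nat ->
          Cdiff (fun u v => gcoef (sys s u v) (q u v) (w u v) j k) a b).
{ intros j k hjk.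
  replace (fun u v => gcoef (sys s u v) (q u v) (w u v) j k) with
    (fun u v => Cconj (snd (w u v)) * snd (q u v) ^ j *
       Cconj (snd (q u v)) ^ k * RtoC (cubic_seq s (j + k) 0))%C.
  - cdiff.
  - apply functional_extensionality; intros u.
    apply functional_extensionality; intros v.
    now rewrite gcoef_sys. }
pose proof (hg 2%nat 0%nat ltac:(lia)) as g20.
pose proof (hg 1%nat 1%nat ltac:(lia)) as g11.
pose proof (hg 0%nat 2%nat ltac:(lia)) as g02.
pose proof (hg 2%nat 1%nat ltac:(lia)) as g21.
assert (h2 : RtoC 2 <> RtoC 0) by (intros h; injection h; lra).
assert (hl0 : lam a b <> RtoC 0) by (intros h; rewrite h in hi; simpl in hi; lra).
assert (hl2 : RtoC (Cmod (lam a b) ^ 2) <> RtoC 0).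
{ intros h; apply RtoC_inj in h; revert h; apply pow_nonzero; intros h'.
  now apply hl0, Cmod_eq_0. }
assert (hl3 : (2 * lam a b - Cconj (lam a b))%C <> RtoC 0).
{ intros h; apply (f_equal Im) in h.
  destruct (lam a b) as [x y]; unfold Im in *; simpl in *; lra. }
assert (hc : Cdiff (fun u v =>
  let g := gcoef (sys s u v) (q u v) (w u v) in
  g 2%nat 0%nat * g 1%nat 1%nat * (2 * lam u v + Cconj (lam u v))
    / (2 * RtoC (Cmod (lam u v) ^ 2))
  + RtoC (Cmod (g 1%nat 1%nat) ^ 2) / lam u v
  + RtoC (Cmod (g 0%nat 2%nat) ^ 2) / (2 * (2 * lam u v - Cconj (lam u v)))
  + g 2%nat 1%nat / 2)%C a b).
{ cbv zeta; cdiff; auto using Cmult_neq_0. }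
destruct hc as [c1 c2], hl as [l1 l2].
apply (Rdiff_minus _ _ a b).
- apply Rdiff_div; [exact c1|exact l2|lra].
- apply (Rdiff_div (fun u v => Re (lam u v) * Im _)
           (fun u v => Im (lam u v) ^ 2)).
  + now apply Rdiff_mult.
  + apply (Rdiff_comp (fun x => x ^ 2)); [auto_derive|]; auto.
  + apply pow_nonzero; lra.
Qed.

(** For lam = i om the terms in |g11|^2 and |g02|^2 are purely imaginary. *)
Lemma lyap1_ext_imaginary (f : planar_field) (om : R) (q w : C * C) :
  0 < om -> lyap1_ext f (Ci * om)%C q w = lyap1 f om q w.
Proof.
intros hom; unfold lyap1_ext, lyap1.
rewrite !Cmod_sqr.
generalize (gcoef f q w 2%nat 0%nat) (gcoef f q w 1%nat 1%nat)
  (gcoef f q w 0%nat 2%nat) (gcoef f q w 2%nat 1%nat).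
intros [a1 a2] [b1 b2] [c1 c2] [d1 d2].
unfold Cdiv, Cinv, Cconj, Cminus, Copp, Cmult, Cplus, Ci, RtoC, Re, Im; simpl.
field; lra.
Qed.

Lemma Cdiff_eig (r p : R) : 0 < Im (eig r p) -> Cdiff eig r p.
Proof.
intros hi; split; unfold eig; simpl.
- apply (Rdiff_comp (fun x => (x - 1) / 2) (fun u _ => u));
    [auto_derive|apply Rdiff_proj1]; auto.
- apply (Rdiff_comp sqrt (fun u v => v - u - ((u - 1) / 2) ^ 2)).
  + apply ex_derive_Reals_1, derivable_pt_sqrt.
    destruct (Rlt_le_dec 0 (p - r - ((r - 1) / 2) ^ 2)) as [h|h]; auto.
    unfold eig in hi; simpl Im in hi; rewrite sqrt_neg_0 in hi; lra.
  + apply Rdiff_minus.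
    * apply Rdiff_minus; [apply Rdiff_proj2|apply Rdiff_proj1].
    * apply (Rdiff_comp (fun x => ((x - 1) / 2) ^ 2) (fun u _ => u));
        [auto_derive|apply Rdiff_proj1]; auto.
Qed.

Lemma Rdiff_lyap1_ext_sys (s r p : R) : 0 < r -> 0 < p -> 0 < Im (eig r p) ->
  Rdiff (fun u v => lyap1_ext (sys s u v) (eig u v)
                      (qvec_ext u v) (wvec_ext u v)) r p.
Proof.
intros hr hp hi.
pose proof (Cdiff_eig r p hi) as he.
pose proof (Cdiff_RtoC _ _ _ (Rdiff_proj2 r p)) as hv.
pose proof (qvec_ext_den r p hr hi) as hden.
apply Rdiff_lyap1_ext; auto; unfold qvec_ext, wvec_ext; cbn [snd]; cdiff; auto.
intros h; injection h; lra.
Qed.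

(** * Values at the bifurcation points *)

Lemma lyap1_sys (s p : R) : 1 < p ->
  lyap1 (sys s 1 p) (freq p) (qvec (freq p)) (wvec (freq p)) =
  p ^ 2 / (8 * freq p ^ 5) * (2 * s ^ 2 - 3 * (p - 1)).
Proof.
intros hp; pose proof (freq_pos p hp).
rewrite lyap1_critical, freq_sqr by assumption.
now replace (1 + (p - 1)) with p by ring.
Qed.

Lemma lyap1_prefactor_pos (p : R) : 1 < p -> 0 < p ^ 2 / (8 * freq p ^ 5).
Proof.
intros hp; pose proof (freq_pos p hp).
apply Rdiv_lt_0_compat; [|apply Rmult_lt_0_compat; [lra|]]; apply pow_lt; lra.
Qed.

Lemma lyap1_ext_critical (s p : R) : 1 < p ->
  lyap1_ext (sys s 1 p) (eig 1 p) (qvec_ext 1 p) (wvec_ext 1 p) =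
  p ^ 2 / (8 * freq p ^ 5) * (2 * s ^ 2 - 3 * (p - 1)).
Proof.
intros hp.
rewrite eig_at_1, qvec_ext_at_1, wvec_ext_at_1 by exact hp.
rewrite lyap1_ext_imaginary by (apply freq_pos, hp).
now apply lyap1_sys.
Qed.

(** The factor 2 s^2 - 3 (p - 1) vanishes at the Bautin point, so only the term
    that differentiates it survives. *)
Lemma Derive_lyap1_ext_critical (s p : R) : 1 < p -> 2 * s ^ 2 = 3 * (p - 1) ->
  Derive (fun v => lyap1_ext (sys s 1 v) (eig 1 v)
                     (qvec_ext 1 v) (wvec_ext 1 v)) p
  = - 3 * (p ^ 2 / (8 * freq p ^ 5)).
Proof.
intros hp hs.
pose proof (freq_pos p hp) as h0.
rewrite (Derive_ext_loc _ (fun v =>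
  v ^ 2 / (8 * freq v ^ 5) * (2 * s ^ 2 - 3 * (v - 1)))).
- rewrite Derive_mult.
  + replace (Derive (fun v => 2 * s ^ 2 - 3 * (v - 1)) p) with (- 3).
    * rewrite hs; ring.
    * symmetry; apply is_derive_unique; auto_derive; auto; ring.
  + unfold freq in *; auto_derive; split; [lra|split; [|auto]].
    apply Rmult_integral_contrapositive_currified; [lra|].
    change (sqrt (p - 1) ^ 5 <> 0); now apply pow_nonzero, Rgt_not_eq.
  + auto_derive; auto.
- assert (hloc : locally p (fun v => 1 < v))
    by (apply (open_gt 1); exact hp).
  revert hloc; apply filter_imp; intros v hv; now apply lyap1_ext_critical.
Qed.

(** The real part of the eigenvalue has differential (1/2, 0), so the
    determinant is half the partial derivative of l1 in p. *)
Lemma regular_at_critical (s p : R) : 1 < p -> 2 * s ^ 2 = 3 * (p - 1) ->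
  regular_at (fun u v => Re (eig u v))
    (fun u v => lyap1_ext (sys s u v) (eig u v)
                  (qvec_ext u v) (wvec_ext u v)) 1 p.
Proof.
intros hp hs.
destruct (locally_2d_singleton _ _ _ (near_critical p hp)) as (h1 & h2 & h3).
destruct (Rdiff_lyap1_ext_sys s 1 p h1 h2 h3) as (ga & gb & hg).
exists (/ 2), 0, ga, gb; split; [|split; [exact hg|]].
- apply (differentiable_pt_lim_proj1_0 (fun u => (u - 1) / 2)).
  apply is_derive_Reals; auto_derive; auto; field.
- destruct (differentiable_pt_lim_unique _ _ _ _ _ hg) as [_ hgb].
  rewrite Derive_lyap1_ext_critical in hgb by assumption.
  pose proof (lyap1_prefactor_pos p hp); lra.
Qed.

Lemma lyap2_sys (s p : R) : 0 < s -> p = 1 + 2 / 3 * s ^ 2 ->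
  lyap2 (sys s 1 p) (freq p) (qvec (freq p)) (wvec (freq p)) =
  - (5 * (3 + 2 * s ^ 2) ^ 4 / (128 * sqrt 6 * s ^ 7)).
Proof.
intros hs hp.
assert (hp1 : 1 < p) by nra.
pose proof (freq_pos p hp1) as hom; pose proof (freq_sqr p hp1) as hom2.
assert (h23 : 2 * s ^ 2 = 3 * freq p ^ 2) by lra.
rewrite lyap2_critical by assumption.
assert (h6 : 0 < sqrt 6) by (apply sqrt_lt_R0; lra).
assert (hsq : sqrt 6 * s = 3 * freq p).
{ apply Rsqr_inj; [nra|nra|].
  unfold Rsqr; pose proof (sqrt_sqrt 6 ltac:(lra)); nra. }
replace (128 * sqrt 6 * s ^ 7) with (16 * (sqrt 6 * s) * (2 * s ^ 2) ^ 3) by ring.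
rewrite hsq, h23; field; lra.
Qed.

Lemma lyap2_value_neg (s : R) : 0 < s ->
  - (5 * (3 + 2 * s ^ 2) ^ 4 / (128 * sqrt 6 * s ^ 7)) < 0.
Proof.
intros hs.
assert (h6 : 0 < sqrt 6) by (apply sqrt_lt_R0; lra).
apply Ropp_lt_gt_0_contravar, Rdiv_lt_0_compat.
- apply Rmult_lt_0_compat; [lra|apply pow_lt; nra].
- apply Rmult_lt_0_compat; [lra|apply pow_lt, hs].
Qed.

Theorem proposition6 (p s : R) (hp : 0 < p) (hs : 0 < s) :
  (1 < p -> hopf_bifurcation (fun r => sys s r p) 1 (freq p)) /\
  (1 < p < 1 + 2 / 3 * s ^ 2 ->
     subcritical_hopf (fun r => sys s r p) 1
       (freq p) (qvec (freq p)) (wvec (freq p))) /\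
  (1 + 2 / 3 * s ^ 2 < p ->
     supercritical_hopf (fun r => sys s r p) 1
       (freq p) (qvec (freq p)) (wvec (freq p))) /\
  (p = 1 + 2 / 3 * s ^ 2 ->
     bautin_bifurcation (sys s) eig qvec_ext wvec_ext 1 p /\
     lyap2 (sys s 1 p) (freq p) (qvec (freq p)) (wvec (freq p)) =
       - (5 * (3 + 2 * s ^ 2) ^ 4 / (128 * sqrt 6 * s ^ 7)) /\
     - (5 * (3 + 2 * s ^ 2) ^ 4 / (128 * sqrt 6 * s ^ 7)) < 0).
Proof.
pose proof (lyap1_prefactor_pos p) as hk.
split; [apply hopf_sys|split; [|split]].
- intros [hp1 hp2]; specialize (hk hp1); split; [now apply hopf_sys|].
  split; [now apply normalized_eigenvectors_critical|].
  rewrite lyap1_sys by exact hp1; nra.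
- intros hp2; assert (hp1 : 1 < p) by nra; specialize (hk hp1).
  split; [now apply hopf_sys|].
  split; [now apply normalized_eigenvectors_critical|].
  rewrite lyap1_sys by exact hp1; nra.
- intros hp2; assert (hp1 : 1 < p) by nra.
  pose proof (lyap2_sys s p hs hp2) as hl2.
  pose proof (lyap2_value_neg s hs) as hneg.
  split; [|split; assumption].
  assert (him : Im (eig 1 p) = freq p)
    by (rewrite eig_at_1; unfold Im, Ci, Cmult, RtoC; simpl; ring).
  split; [|split; [|split; [|split]]].
  + eapply locally_2d_impl; [|exact (near_critical p hp1)].
    apply locally_2d_forall; intros u v (hu & hv & hi).
    split; [apply equilibrium_sys|].
    split; [exact hi|now apply normalized_eigenvectors_ext].
  + unfold eig; simpl; field.
  + rewrite him, qvec_ext_at_1, wvec_ext_at_1, lyap1_sys by exact hp1.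
    rewrite hp2 at 3; field.
    apply Rgt_not_eq, freq_pos, hp1.
  + rewrite him, qvec_ext_at_1, wvec_ext_at_1, hl2 by exact hp1; lra.
  + apply regular_at_critical; lra.
Qed.
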